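(* Let $\alpha\geq 1$. Then: (1) $S_n$ has the maximum value of $Pl_\alpha$ among all $n$-vertex trees; (2) $S_n^+$ has the maximum value of $Pl_\alpha$ among all $n$-vertex unicyclic graphs; (3) $B_1$ has the maximum value of $Pl_\alpha$ among all $n$-vertex bicyclic graphs; (4) for $n\geq 5$, the maximum value of $Pl_\alpha$ among all $n$-vertex tricyclic graphs is attained by $G_4$ or $G_5$; more precisely, $Pl_\alpha(G_4)<Pl_\alpha(G_5)$ for $1<\alpha<2$, $Pl_\alpha(G_4)>Pl_\alpha(G_5)$ for $\alpha>2$, and $Pl_\alpha(G_4)=Pl_\alpha(G_5)$ for $\alpha\in\{1,2\}$; (5) for $n\geq 6$, $H_4$ has the maximum value of $Pl_\alpha$ among all $n$-vertex tetracyclic graphs, and for $n=5$, $H_5$ has the maximum value of $Pl_\alpha$ among all $5$-vertex tetracyclic graphs.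
   Context: All graphs are finite, simple, undirected and connected. A connected graph with $n$ vertices and $m$ edges is a tree, unicyclic, bicyclic, tricyclic, tetracyclic graph if $m=n-1,n,n+1,n+2,n+3$ respectively. The general Platt index is $Pl_\alpha(G)=\sum_{uv\in E(G)}(d_u+d_v-2)^\alpha$, $d_u$ the degree of $u$. $S_n$ is the star on $n$ vertices. The following graphs are obtained from $S_n$ by adding edges between leaves: $S_n^+$: add one edge; $B_1$: add two edges sharing a common leaf; $G_4$: join one leaf to three other leaves (requires $n\ge5$); $G_5$: add the three edges of a triangle on three leaves; $H_4$: join one leaf to four other leaves (requires $n\ge6$); $H_5$: add on four leaves $v_1,\dots,v_4$ the edges $v_1v_2,v_2v_3,v_3v_1,v_1v_4$. Statements (1)–(3) are for those $n$ for which the respective graphs exist. *)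

(* Defs.v *)
From HB Require Import structures.
From mathcomp Require Import all_boot all_order all_algebra.
From mathcomp Require Import reals exp.

Set Implicit Arguments.
Unset Strict Implicit.
Unset Printing Implicit Defensive.

Import Order.TTheory GRing.Theory Num.Theory.

Definition simple_graph (n : nat) (e : rel 'I_n) : Prop :=
  symmetric e /\ irreflexive e.

Definition connected_graph (n : nat) (e : rel 'I_n) : Prop :=
  forall u v : 'I_n, connect e u v.

Definition nedges (n : nat) (e : rel 'I_n) : nat :=
  #|[set p : 'I_n * 'I_n | (val p.1 < val p.2)%N && e p.1 p.2]|.

Definition deg (n : nat) (e : rel 'I_n) (u : 'I_n) : nat := #|[set v | e u v]|.

Definition cyclic_class (c n : nat) (e : rel 'I_n) : Prop :=
  simple_graph e /\ connected_graph e /\ (nedges e + 1 = n + c)%N.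

Definition is_tree n (e : rel 'I_n) := cyclic_class 0 e.
Definition is_unicyclic n (e : rel 'I_n) := cyclic_class 1 e.
Definition is_bicyclic n (e : rel 'I_n) := cyclic_class 2 e.
Definition is_tricyclic n (e : rel 'I_n) := cyclic_class 3 e.
Definition is_tetracyclic n (e : rel 'I_n) := cyclic_class 4 e.

Definition Platt (R : realType) (alpha : R) (n : nat) (e : rel 'I_n) : R :=
  \sum_(p : 'I_n * 'I_n | (val p.1 < val p.2)%N && e p.1 p.2)
     powR ((deg e p.1 + deg e p.2 - 2)%N%:R) alpha.

Definition star_plus (L : seq (nat * nat)) (n : nat) : rel 'I_n :=
  fun u v => (val u != val v) &&
    [|| val u == 0%N, val v == 0%N, (val u, val v) \in L | (val v, val u) \in L].

Arguments star_plus : clear implicits.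
Definition Star n := star_plus [::] n.
Definition Star_plus n := star_plus [:: (1, 2)]%N n.
Definition B1 n := star_plus [:: (1, 2); (1, 3)]%N n.
Definition G4 n := star_plus [:: (1, 2); (1, 3); (1, 4)]%N n.
Definition G5 n := star_plus [:: (1, 2); (2, 3); (1, 3)]%N n.
Definition H4 n := star_plus [:: (1, 2); (1, 3); (1, 4); (1, 5)]%N n.
Definition H5 n := star_plus [:: (1, 2); (2, 3); (3, 1); (1, 4)]%N n.
Arguments Star : clear implicits.
Arguments Star_plus : clear implicits.
Arguments B1 : clear implicits.
Arguments G4 : clear implicits.
Arguments G5 : clear implicits.
Arguments H4 : clear implicits.
Arguments H5 : clear implicits.

(* Main.v *)
(* A Kelmans compression (moving to i the neighbours of j not adjacent to i)
   keeps the number of edges, keeps the graph connected when i and j are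
   adjacent or have a common neighbour, and does not decrease Pl_alpha when
   alpha >= 1, since t |-> t^alpha is convex and nondecreasing. Compressing
   towards smaller labels until nothing moves makes vertex 0 universal, and the
   c <= 4 remaining edges ab (a < b) form a set closed under decreasing a and b.
   For c <= 2 this set is unique; for c = 3 it is a star or a triangle (G4 or
   G5), for c = 4 a star or a triangle with a pendant edge (H4 or H5). Both
   remaining comparisons come from the third difference of t^alpha, whose sign
   is that of alpha (alpha - 1) (alpha - 2). *)
Require Import Defs.
From HB Require Import structures.
From mathcomp Require Import all_boot all_order all_algebra.
From mathcomp Require Import reals exp.
From mathcomp Require Import boolp classical_sets topology normedtype derive realfun.
From mathcomp Require Import zify ring lra.
Import Order.TTheory GRing.Theory Num.Theory numFieldNormedType.Exports.
Local Open Scope ring_scope.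

Set Implicit Arguments.
Unset Strict Implicit.
Unset Printing Implicit Defensive.

(** * Signs of the finite differences of power functions *)

Section FiniteDifferences.
Context {R : realType}.
Implicit Types (a x : R) (f g df dg : R -> R).

(** By the mean value theorem on [[x, x + 1]]. It passes from the sign of the derivative of one
    difference to the sign of the next difference. *)
Lemma increment_gt0 f df x :
    (forall y, x <= y -> is_derive y 1 f (df y)) ->
    (forall y, x <= y -> 0 < df y) ->
  f x < f (x + 1).
Proof.
move=> f_der df_gt0.
have lt_x : x < x + 1 by lra.
have f_der_in y : y \in `]x, x + 1[%R -> is_derive y 1 f (df y).
  by move=> /itvP y_in; apply: f_der; rewrite y_in.
have [|c c_in fE] := MVT lt_x f_der_in.
  apply: derivable_within_continuous => y /itvP y_in.
  by have [] := f_der y _ => //; rewrite y_in.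
rewrite -subr_gt0 fE; apply: mulr_gt0; last lra.
by apply: df_gt0; rewrite (itvP c_in).
Qed.

Definition fdiff1 a x := (x + 1) `^ a - x `^ a.
Definition fdiff2 a x := fdiff1 a (x + 1) - fdiff1 a x.
Definition fdiff3 a x := fdiff2 a (x + 1) - fdiff2 a x.

Lemma is_derive_shift f (l : R) x : is_derive (x + 1) 1 f l ->
  is_derive x 1 (fun y => f (y + 1)) l.
Proof.
move=> f_der.
have h : is_derive x 1 (fun y : R => y + 1) 1.
  have := @is_deriveD _ _ _ (fun y : R => y) (fun=> 1) x 1 1 0.
  by rewrite addr0; apply.
have := @is_derive1_comp _ f (fun y => y + 1) x l 1 f_der h.
by rewrite mulr1.
Qed.

Lemma is_derive_increment f df x :
    is_derive x 1 f (df x) -> is_derive (x + 1) 1 f (df (x + 1)) ->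
  is_derive x 1 (fun y => f (y + 1) - f y) (df (x + 1) - df x).
Proof. by move=> fx fx1; apply: is_deriveB; exact: is_derive_shift. Qed.

(** Differencing commutes with differentiation, so the derivative of a difference of [t^a] is [a]
    times the same difference of [t^(a - 1)]. Each sign statement below thus reduces to one of lower
    order with the exponent lowered by one. *)
Lemma is_derive_fdiff1 a x : 0 < x ->
  is_derive x 1 (fdiff1 a) (a * fdiff1 (a - 1) x).
Proof.
move=> x_gt0; rewrite /fdiff1 mulrBr.
by apply: (@is_derive_increment _ (fun y => a * y `^ (a - 1)));
  apply: is_derive1_powR; lra.
Qed.

Lemma is_derive_fdiff2 a x : 0 < x ->
  is_derive x 1 (fdiff2 a) (a * fdiff2 (a - 1) x).
Proof.
move=> x_gt0; rewrite /fdiff2 mulrBr.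
by apply: (@is_derive_increment _ (fun y => a * fdiff1 (a - 1) y));
  apply: is_derive_fdiff1; lra.
Qed.

Lemma fdiff1_gt0 a x : 0 < x -> 0 < a -> 0 < fdiff1 a x.
Proof.
move=> x_gt0 a_gt0; rewrite subr_gt0.
by apply: gt0_ltr_powR; rewrite ?nnegrE; lra.
Qed.

Lemma fdiff1_lt0 a x : 0 < x -> a < 0 -> fdiff1 a x < 0.
Proof.
move=> x_gt0 a_lt0; rewrite -[a]opprK /fdiff1 !(powRN _ (- a)) subr_lt0.
by rewrite ltf_pV2 ?posrE ?powR_gt0 ?gt0_ltr_powR ?nnegrE; lra.
Qed.

Lemma fdiff2_gt0 a x : 0 < x -> 1 < a -> 0 < fdiff2 a x.
Proof.
move=> x_gt0 a_gt1; rewrite subr_gt0.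
apply: (@increment_gt0 _ (fun y => a * fdiff1 (a - 1) y)) => y xy.
  by apply: is_derive_fdiff1; lra.
by apply: mulr_gt0; [lra | apply: fdiff1_gt0; lra].
Qed.

Lemma fdiff2_lt0 a x : 0 < x -> 0 < a < 1 -> fdiff2 a x < 0.
Proof.
move=> x_gt0 /andP[a_gt0 a_lt1]; rewrite subr_lt0 -ltrN2.
(* [increment_gt0] only treats increasing functions, so it is applied to the negated difference; the
   exponent [a - 1] is negative here. *)
apply: (@increment_gt0 (fun y => - fdiff1 a y) (fun y => - (a * fdiff1 (a - 1) y))) => y xy.
  by apply: is_deriveN; apply: is_derive_fdiff1; lra.
rewrite -mulrN; apply: mulr_gt0 => //.
by rewrite oppr_gt0; apply: fdiff1_lt0; lra.
Qed.

Lemma fdiff3_gt0 a x : 0 < x -> 2 < a -> 0 < fdiff3 a x.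
Proof.
move=> x_gt0 a_gt2; rewrite subr_gt0.
apply: (@increment_gt0 _ (fun y => a * fdiff2 (a - 1) y)) => y xy.
  by apply: is_derive_fdiff2; lra.
by apply: mulr_gt0; [lra | apply: fdiff2_gt0; lra].
Qed.

Lemma fdiff3_lt0 a x : 0 < x -> 1 < a < 2 -> fdiff3 a x < 0.
Proof.
move=> x_gt0 /andP[a_gt1 a_lt2]; rewrite subr_lt0 -ltrN2.
apply: (@increment_gt0 (fun y => - fdiff2 a y) (fun y => - (a * fdiff2 (a - 1) y))) => y xy.
  by apply: is_deriveN; apply: is_derive_fdiff2; lra.
rewrite -mulrN; apply: mulr_gt0; first lra.
by rewrite oppr_gt0; apply: fdiff2_lt0; lra.
Qed.

Lemma fdiff2_1 x : 0 <= x -> fdiff2 1 x = 0.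
Proof. by move=> x0; rewrite /fdiff2 /fdiff1 !powRr1; lra. Qed.

Lemma fdiff3_1 x : 0 <= x -> fdiff3 1 x = 0.
Proof. by move=> x0; rewrite /fdiff3 !fdiff2_1; lra. Qed.

Lemma fdiff3_2 x : 0 <= x -> fdiff3 2 x = 0.
Proof.
by move=> x0; rewrite /fdiff3 /fdiff2 /fdiff1 !(powR_mulrn 2); lra.
Qed.

Lemma fdiff2_ge0 a x : 0 < x -> 1 <= a -> 0 <= fdiff2 a x.
Proof.
move=> x_gt0; rewrite le_eqVlt => /orP[/eqP <-|a_gt1].
  by rewrite fdiff2_1 // ltW.
by rewrite ltW // fdiff2_gt0.
Qed.

Lemma fdiff3_ge0 a x : 0 < x -> 2 <= a -> 0 <= fdiff3 a x.
Proof.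
move=> x_gt0; rewrite le_eqVlt => /orP[/eqP <-|a_gt2].
  by rewrite fdiff3_2 // ltW.
by rewrite ltW // fdiff3_gt0.
Qed.

Lemma fdiff3_le0 a x : 0 < x -> 1 <= a <= 2 -> fdiff3 a x <= 0.
Proof.
move=> x_gt0 /andP[]; rewrite le_eqVlt => /orP[/eqP <- _|a_gt1].
  by rewrite fdiff3_1 // ltW.
rewrite le_eqVlt => /orP[/eqP ->|a_lt2]; first by rewrite fdiff3_2 // ltW.
by rewrite ltW // fdiff3_lt0 // a_gt1.
Qed.

End FiniteDifferences.

(** * Convex sequences *)

Section ConvexSequence.
Variables (R : realDomainType) (F : nat -> R).
Hypothesis F_convex : forall k, F k.+1 - F k <= F k.+2 - F k.+1.

Lemma convex_increment_homo a b : (a <= b)%N ->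
  F a.+1 - F a <= F b.+1 - F b.
Proof.
elim: b => [|b IH]; first by rewrite leqn0 => /eqP ->.
rewrite leq_eqVlt => /orP[/eqP -> //|]; rewrite ltnS => /IH h.
exact: le_trans h (F_convex b).
Qed.

(** Two pairs of indices with equal sums, the right one more spread out. Raising [t] by one adds the
    increment at [a + t] on the left and the larger one at [a + s + t] on the right. *)
Lemma convex_spread a s t : F (a + s)%N + F (a + t)%N <= F a + F (a + s + t)%N.
Proof.
elim: t => [|t IH]; first by rewrite !addn0 addrC.
rewrite !addnS; have := @convex_increment_homo (a + t)%N (a + s + t)%N.
have -> : (a + t <= a + s + t)%N by lia.
by move=> /(_ isT); lra.
Qed.

End ConvexSequence.


(** * Kelmans compressions *)

(** Termination measure for the compressions: moving edges to a smaller label lowers it. *)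
Definition potential n (e : rel 'I_n) : nat := (\sum_(x : 'I_n) x * deg e x)%N.

(** Summing over ordered pairs counts every edge twice, but avoids the orientation by labels, so
    that the sum splits freely at [i] and [j]. *)
Definition degree_sum (R : realDomainType) (F : nat -> R) n (e : rel 'I_n) : R :=
  \sum_(x : 'I_n) \sum_(y : 'I_n) if e x y then F (deg e x + deg e y)%N else 0.

Lemma degE n (e : rel 'I_n) x : deg e x = (\sum_(y : 'I_n) e x y)%N.
Proof.
rewrite /deg -sum1_card big_mkcond; apply: eq_bigr => y _.
by rewrite inE; case: (e x y).
Qed.

Lemma big_split_pair (R : Type) (idx : R) (op : Monoid.com_law idx) (n : nat)
    (i j : 'I_n) (f : 'I_n -> R) : i != j ->
  \big[op/idx]_(y : 'I_n) f y =
  op (f i) (op (f j) (\big[op/idx]_(y : 'I_n | (y != i) && (y != j)) f y)).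
Proof. by move=> ij; rewrite (bigD1 i) //= (bigD1 j) // eq_sym. Qed.

Section Kelmans.
Variables (n : nat) (e : rel 'I_n) (i j : 'I_n).

Definition kelmans : rel 'I_n := fun x y =>
  if x == i then (if (y == i) || (y == j) then e x y else e i y || e j y)
  else if x == j then (if (y == i) || (y == j) then e x y else e i y && e j y)
  else if y == i then e x i || e x j
  else if y == j then e x i && e x j
  else e x y.

Hypotheses (e_sym : symmetric e) (e_irr : irreflexive e) (ij : i != j).

Lemma kelmans_simple : simple_graph kelmans.
Proof.
split=> [x y|x]; rewrite /kelmans.
  have := ij; rewrite !(e_sym _ x) !(e_sym _ y) !(e_sym y x) !(e_sym _ i) !(e_sym _ j).
  by do ![case: eqVneq => ? //=; subst => //=] => //; rewrite ?eqxx.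
by do ![case: eqVneq => ? //=; subst => //=].
Qed.

Lemma kelmansij : kelmans i j = e i j.
Proof. by rewrite /kelmans !eqxx orbT. Qed.

Lemma kelmansi y : y != i -> y != j -> kelmans i y = e i y || e j y.
Proof. by move=> /negPf yi /negPf yj; rewrite /kelmans eqxx yi yj. Qed.

Lemma kelmansj y : y != i -> y != j -> kelmans j y = e i y && e j y.
Proof.
by move=> /negPf yi /negPf yj; rewrite /kelmans eqxx yi yj eq_sym (negPf ij).
Qed.

Lemma kelmans_off x y : x != i -> x != j -> y != i -> y != j ->
  kelmans x y = e x y.
Proof.
by move=> /negPf xi /negPf xj /negPf yi /negPf yj; rewrite /kelmans xi xj yi yj.
Qed.

(** The union at [i] and the intersection at [j] together contain [x] as often as the two old
    neighbourhoods did. The same count gives [deg_kelmans_add]. *)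
Lemma deg_kelmans_off x : x != i -> x != j -> deg kelmans x = deg e x.
Proof.
move=> xi xj; have [k_sym _] := kelmans_simple.
rewrite !degE !(@big_split_pair _ _ _ _ _ _ _ ij) /= !addnA; congr addn.
  rewrite !(k_sym x) !(e_sym x) kelmansi // kelmansj //.
  by case: (e i x); case: (e j x).
by apply: eq_bigr => y /andP[yi yj]; rewrite kelmans_off.
Qed.

Lemma deg_kelmans_add : (deg kelmans i + deg kelmans j = deg e i + deg e j)%N.
Proof.
have [k_sym k_irr] := kelmans_simple.
rewrite !degE !(@big_split_pair _ _ _ _ _ _ _ ij) /= !k_irr !e_irr.
rewrite (k_sym j) (e_sym j i) kelmansij.
rewrite !add0n addnACA [RHS]addnACA -!big_split /=; congr addn.
apply: eq_bigr => y /andP[yi yj]; rewrite kelmansi // kelmansj //.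
by case: (e i y); case: (e j y).
Qed.

Lemma deg_kelmans_lei : (deg kelmans j <= deg e i)%N.
Proof.
have [k_sym k_irr] := kelmans_simple.
rewrite !degE !(@big_split_pair _ _ _ _ _ _ _ ij) /= k_irr e_irr.
rewrite k_sym kelmansij !add0n leq_add2l; apply: leq_sum => y /andP[yi yj].
by rewrite kelmansj //; case: (e i y); case: (e j y).
Qed.

Lemma deg_kelmans_lej : (deg kelmans j <= deg e j)%N.
Proof.
have [k_sym k_irr] := kelmans_simple.
rewrite !degE !(@big_split_pair _ _ _ _ _ _ _ ij) /= k_irr e_irr.
rewrite k_sym kelmansij e_sym !add0n leq_add2l; apply: leq_sum => y /andP[yi yj].
by rewrite kelmansj //; case: (e i y); case: (e j y).
Qed.

Lemma deg_kelmans_ltj w : w != i -> e j w -> ~~ e i w ->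
  (deg kelmans j < deg e j)%N.
Proof.
move=> wi jw niw; have wj : w != j by apply: contraTneq jw => ->; rewrite e_irr.
have [k_sym k_irr] := kelmans_simple.
rewrite !degE !(@big_split_pair _ _ _ _ _ _ _ ij) /= k_irr e_irr.
rewrite k_sym kelmansij e_sym !add0n ltn_add2l.
rewrite (bigD1 w) ?wi //= [ltnRHS](bigD1 w) ?wi //= kelmansj // jw (negPf niw).
rewrite add0n add1n ltnS; apply: leq_sum => y /andP[/andP[yi yj] _].
by rewrite kelmansj //; case: (e i y); case: (e j y).
Qed.

Lemma potential_kelmans w : (i < j)%N -> w != i -> e j w -> ~~ e i w ->
  (potential kelmans < potential e)%N.
Proof.
move=> lt_ij wi jw niw; rewrite /potential !(@big_split_pair _ _ _ _ _ _ _ ij) /=.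
rewrite (eq_bigr (fun x : 'I_n => x * deg e x)%N); last first.
  by move=> x /andP[xi xj]; rewrite deg_kelmans_off.
rewrite !addnA ltn_add2r.
have := deg_kelmans_add; have := @deg_kelmans_ltj w wi jw niw.
(* At least one unit of degree passes from [j] to [i], the total being fixed, and its weight drops
   because [i < j]. *)
by move: (deg kelmans i) (deg kelmans j) => a b lt_b; nia.
Qed.

Lemma double_sum_split (R : realDomainType) (w : 'I_n -> 'I_n -> R) :
    (forall x y, w x y = w y x) -> (forall x, w x x = 0) ->
  \sum_x \sum_y w x y =
  \sum_(x | (x != i) && (x != j)) \sum_(y | (y != i) && (y != j)) w x y +
  2 * w i j + 2 * \sum_(y | (y != i) && (y != j)) (w i y + w j y).
Proof.
move=> w_sym w0; rewrite (@big_split_pair _ _ _ _ _ _ _ ij) /=.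
under [X in _ + (_ + X)]eq_bigr => x _.
  rewrite (@big_split_pair _ _ _ _ _ _ _ ij) /= addrA (w_sym x i) (w_sym x j).
  over.
rewrite !(@big_split_pair _ _ _ _ _ _ _ ij) /= !big_split /= !w0 (w_sym j i).
by ring.
Qed.

(** Edges away from [i] and [j] keep their end degrees, and an edge [ij] keeps its degree sum. The
    edges from [i] and [j] to another vertex [y] are compared separately for each [y]. *)
Lemma degree_sum_kelmans (R : realDomainType) (F : nat -> R) :
    (forall k, F k.+1 - F k <= F k.+2 - F k.+1) -> {homo F : x y / (x <= y)%N >-> x <= y} ->
  degree_sum F e <= degree_sum F kelmans.
Proof.
move=> F_convex F_homo; have [k_sym k_irr] := kelmans_simple.
rewrite /degree_sum !double_sum_split; first last.
- by move=> x; rewrite e_irr.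
- by move=> x y; rewrite e_sym addnC.
- by move=> x; rewrite k_irr.
- by move=> x y; rewrite k_sym addnC.
rewrite kelmansij deg_kelmans_add; apply: lerD.
  rewrite lerD2r le_eqVlt; apply/orP; left; apply/eqP.
  apply: eq_bigr => x /andP[xi xj]; apply: eq_bigr => y /andP[yi yj].
  by rewrite kelmans_off // !deg_kelmans_off.
rewrite ler_pM2l ?ltr0n //; apply: ler_sum => y /andP[yi yj].
rewrite kelmansi // kelmansj // (deg_kelmans_off yi yj).
have := deg_kelmans_add; have := deg_kelmans_lei; have := deg_kelmans_lej.
move: (deg kelmans i) (deg kelmans j) => a b b_le_j b_le_i ab.
case: (e i y); case: (e j y) => //=; rewrite ?addr0 ?add0r.
(* If [y] is adjacent to both, both edges stay. The new degrees [a], [b] have the old sum and [b] is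
   at most both old degrees, so convexity applies. If [y] is adjacent to only one, the edge ends up
   at [i], whose new degree is at least both old ones, and monotonicity suffices. *)
- have := @convex_spread _ _ F_convex (b + deg e y) (deg e i - b) (deg e j - b).
  have -> : (b + deg e y + (deg e i - b) = deg e i + deg e y)%N by lia.
  have -> : (b + deg e y + (deg e j - b) = deg e j + deg e y)%N by lia.
  have -> : (deg e i + deg e y + (deg e j - b) = a + deg e y)%N by lia.
  by rewrite [F (a + _)%N + _]addrC.
- by apply: F_homo; lia.
- by apply: F_homo; lia.
Qed.

(** Every old edge is replaced by a path. An edge [jy] that is lost becomes a path through [i],
    since [i] and [j] remain linked by their edge or by a common neighbour, which compression keeps
    adjacent to both. *)
Lemma kelmans_connected : connected_graph e ->
    (e i j || [exists x, e i x && e j x]) -> connected_graph kelmans.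
Proof.
move=> e_conn near u v; have [k_sym k_irr] := kelmans_simple.
have csym : connect_sym kelmans by apply: sym_connect_sym.
have cij : connect kelmans i j.
  case/orP: near => [h|/existsP[x /andP[ix jx]]].
    by apply: connect1; rewrite kelmansij.
  have xi : x != i by apply: contraTneq ix => ->; rewrite e_irr.
  have xj : x != j by apply: contraTneq jx => ->; rewrite e_irr.
  apply: (@connect_trans _ _ x); first by apply: connect1; rewrite kelmansi // ix.
  by rewrite csym; apply: connect1; rewrite kelmansj // ix jx.
have at_i y : e i y -> connect kelmans i y.
  move=> iy; have [-> //|yj] := eqVneq y j.
  have yi : y != i by apply: contraTneq iy => ->; rewrite e_irr.
  by apply: connect1; rewrite kelmansi // iy.
have at_j y : e j y -> connect kelmans j y.
  move=> jy; have [->|yi] := eqVneq y i; first by rewrite csym.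
  have yj : y != j by apply: contraTneq jy => ->; rewrite e_irr.
  apply: (@connect_trans _ _ i); first by rewrite csym.
  by apply: connect1; rewrite kelmansi // jy orbT.
suff /connect_sub : subrel e (connect kelmans) by apply; exact: e_conn.
move=> x y xy.
have [xi|xi] := eqVneq x i; first by subst; exact: at_i.
have [xj|xj] := eqVneq x j; first by subst; exact: at_j.
have [yi|yi] := eqVneq y i; first by subst; rewrite csym; apply: at_i; rewrite e_sym.
have [yj|yj] := eqVneq y j; first by subst; rewrite csym; apply: at_j; rewrite e_sym.
by apply: connect1; rewrite kelmans_off.
Qed.

End Kelmans.

(** * Degree sums as sums over edges *)

Lemma degree_sum_edges (R : realDomainType) (F : nat -> R) n (e : rel 'I_n) :
    simple_graph e ->
  degree_sum F e =
  2 * \sum_(p : 'I_n * 'I_n | (val p.1 < val p.2)%N && e p.1 p.2)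
         F (deg e p.1 + deg e p.2)%N.
Proof.
move=> [e_sym e_irr]; rewrite /degree_sum pair_big -big_mkcond /=.
rewrite (bigID (fun p : 'I_n * 'I_n => (val p.1 < val p.2)%N)) /=.
rewrite mulrDl mul1r; congr (_ + _); first by apply: eq_bigl => p; rewrite andbC.
(* Swapping the ends turns the second half of the ordered pairs into the first; the diagonal
   contributes nothing, as there are no loops. *)
rewrite (reindex_inj (h := fun p : 'I_n * 'I_n => (p.2, p.1))) /=; last first.
  by move=> [a b] [a' b'] [-> ->].
apply: eq_big => [[a b]|[a b] _] /=; last by rewrite addnC.
rewrite e_sym -leqNgt leq_eqVlt andbC.
case: (boolP (e a b)) => [ab|]; last by rewrite !andbF.
rewrite !andbT; case: eqVneq => // /val_inj ab_eq.
by rewrite ab_eq e_irr in ab.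
Qed.

(** An edge [uv] has degree [d_u + d_v - 2] in the line graph; this is its contribution as a
    function of that degree. *)
Definition line_pow (R : realType) (alpha : R) (k : nat) : R := k%:R `^ alpha.

Lemma Platt_degree_sum (R : realType) (alpha : R) n (e : rel 'I_n) :
    simple_graph e ->
  degree_sum (fun k => line_pow alpha (k - 2)) e = 2 * Platt alpha e.
Proof. by move=> e_simple; rewrite degree_sum_edges. Qed.

Lemma nedges_degree_sum n (e : rel 'I_n) : simple_graph e ->
  degree_sum (fun=> 1) e = 2 * (nedges e)%:R :> int.
Proof.
move=> e_simple; rewrite degree_sum_edges //; congr (_ * _).
by rewrite sumr_const; congr (_ *+ _); apply: eq_card => p; rewrite !inE.
Qed.

Lemma nedges_kelmans n (e : rel 'I_n) (i j : 'I_n) : simple_graph e -> i != j ->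
  nedges (kelmans e i j) = nedges e.
Proof.
move=> e_simple ij; have [e_sym e_irr] := e_simple.
have k_simple := kelmans_simple e_sym e_irr ij.
(* The constants 1 and -1 are both convex and nondecreasing. *)
have le1 := @degree_sum_kelmans _ e i j e_sym e_irr ij int (fun=> 1) (fun=> lexx _)
  (fun _ _ _ => lexx _).
have le2 := @degree_sum_kelmans _ e i j e_sym e_irr ij int (fun=> -1) (fun=> lexx _)
  (fun _ _ _ => lexx _).
have opp (g : rel 'I_n) : degree_sum (fun=> -1) g = - degree_sum (fun=> 1) g :> int.
  rewrite /degree_sum -sumrN; apply: eq_bigr => x _; rewrite -sumrN.
  by apply: eq_bigr => y _; case: (g x y) => //; rewrite oppr0.
by move: le1 le2; rewrite !opp !nedges_degree_sum //; lia.
Qed.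

(** * Graphs that no compression changes *)

(** No compression towards a smaller label moves anything, among those for which [kelmans_connected]
    preserves connectedness. *)
Definition compressed n (e : rel 'I_n) : Prop :=
  forall i j w : 'I_n, (i < j)%N -> w != i -> e j w ->
    e i j || [exists x, e i x && e j x] -> e i w.

Lemma compressed_exists (R : realType) (alpha : R) n (e : rel 'I_n) :
    (forall k, line_pow alpha k.+1 - line_pow alpha k <=
               line_pow alpha k.+2 - line_pow alpha k.+1) ->
    line_pow alpha 0 = 0 -> {homo line_pow alpha : x y / (x <= y)%N >-> x <= y} ->
    simple_graph e -> connected_graph e ->
  exists e' : rel 'I_n, [/\ simple_graph e', connected_graph e',
    nedges e' = nedges e, Platt alpha e <= Platt alpha e' & compressed e'].
Proof.
move=> f_convex f0 f_homo.
have F_homo : {homo (fun k => line_pow alpha (k - 2)) : x y / (x <= y)%N >-> x <= y}.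
  by move=> x y xy; apply: f_homo; lia.
have F_convex k : line_pow alpha (k.+1 - 2) - line_pow alpha (k - 2) <=
    line_pow alpha (k.+2 - 2) - line_pow alpha (k.+1 - 2).
  (* Truncated subtraction makes the shifted sequence constant on 0, 1, 2. Convexity survives at
     this start because [line_pow] is nondecreasing. *)
  case: k => [|[|k]].
  - by rewrite !subrr.
  - by rewrite subrr subr_ge0; apply: f_homo.
  - by rewrite !subSS !subn0.
have [N] := ubnP (potential e); elim: N e => // N IH e; rewrite ltnS => pot_le.
move=> e_simple e_conn; have [e_sym e_irr] := e_simple.
(* Either some triple [(i, j, w)] violates compressedness, and compressing [j] into [i] lowers the
   potential, or the graph is already compressed. *)
case: (pickP (fun q : 'I_n * 'I_n * 'I_n => [&& (q.1.1 < q.1.2)%N, q.2 != q.1.1,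
    e q.1.2 q.2, e q.1.1 q.1.2 || [exists x, e q.1.1 x && e q.1.2 x]
    & ~~ e q.1.1 q.2])) => [[[i j] w] /= /and5P[ij wi jw near niw]|none].
  have ij' : i != j by apply: contraTneq ij => ->; rewrite ltnn.
  have pot := potential_kelmans e_sym e_irr ij' ij wi jw niw.
  have k_simple := kelmans_simple e_sym e_irr ij'.
  have k_conn := kelmans_connected e_sym e_irr ij' e_conn near.
  have [e' [s' c' n' p' comp']] := IH _ (leq_trans pot pot_le) k_simple k_conn.
  exists e'; split => //; first by rewrite n' nedges_kelmans.
  apply: le_trans p'.
  have := degree_sum_kelmans e_sym e_irr ij' F_convex F_homo.
  by rewrite !Platt_degree_sum // ler_pM2l.
exists e; split => // i j w ij wi jw near.
by have := none (i, j, w); rewrite /= ij wi jw near => /negbT; rewrite negbK.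
Qed.

(** Vertex 0 and its neighbours form a set closed under adjacency: a neighbour [y] of a neighbour
    [x] of 0 would move to 0 when [x] is compressed into 0. Connectedness then makes this set
    everything. *)
Lemma compressed_universal n (e : rel 'I_n.+1) : simple_graph e ->
    connected_graph e -> compressed e ->
  forall v, v != ord0 -> e ord0 v.
Proof.
move=> [e_sym e_irr] e_conn e_comp v v0.
have csym : connect_sym e by apply: sym_connect_sym.
have /closed_connect/(_ _ _ (e_conn ord0 v)) :
    fingraph.closed e [pred x | (x == ord0) || e ord0 x].
  apply: intro_closed => // x y xy; rewrite !inE => /orP[/eqP x0|x_nbr].
    by rewrite -x0 xy orbT.
  have [->//|y0 /=] := eqVneq y ord0; apply: (e_comp ord0 x y) => //.
    by rewrite /= lt0n; change (x != ord0); apply: contraTneq x_nbr => ->; rewrite e_irr.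
  by rewrite x_nbr.
by rewrite !inE eqxx (negPf v0).
Qed.

(** The universal vertex 0 is a common neighbour of [i] and [j], so every such compression is
    allowed. *)
Lemma compressed_shifted n (e : rel 'I_n.+1) : simple_graph e ->
    connected_graph e -> compressed e ->
  forall i j w : 'I_n.+1, (0 < i < j)%N -> w != i -> e j w -> e i w.
Proof.
move=> e_simple e_conn e_comp i j w /andP[i0 ij] wi jw.
have [e_sym _] := e_simple; have univ := compressed_universal e_simple e_conn e_comp.
apply: (e_comp i j) => //; apply/orP; right; apply/existsP; exists ord0.
by rewrite !(e_sym _ ord0) !univ // -val_eqE -lt0n //=; apply: ltn_trans ij.
Qed.

(* The edges of [star_plus L n] beyond those of the star, each listed once. *)
Definition extra_edges n (L : seq (nat * nat)) :=
  uniq L && all (fun p => (0 < p.1 < p.2)%N && (p.2 < n)%N) L.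

Definition pair_val n (p : 'I_n * 'I_n) : nat * nat := (val p.1, val p.2).

Lemma pair_val_inj n : injective (@pair_val n).
Proof. by move=> [a b] [a' b'] [/val_inj -> /val_inj ->]. Qed.

(** * Edges, degrees and Platt index of a star with extra edges *)

Section StarPlus.
Variables (n : nat) (L : seq (nat * nat)).
Hypothesis L_ok : extra_edges n.+1 L.
Local Notation sp := (@star_plus L n.+1).

Lemma extra_edge_bounds a b : (a, b) \in L -> [/\ 0 < a, a < b & b < n.+1]%N.
Proof.
by case/andP: L_ok => _ /allP L_all /L_all /= /andP[/andP[? ?] ?].
Qed.

Lemma star_plus_lt (u v : 'I_n.+1) : (u < v)%N ->
  sp u v = (u == 0 :> nat) || (pair_val (u, v) \in L).
Proof.
move=> uv; rewrite /star_plus /pair_val /= neq_ltn uv /=; congr (_ || _).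
have -> : (val v == 0%N) = false by rewrite eqn0Ngt (leq_ltn_trans _ uv).
case: ((val v, val u) \in L) / idP => [vu|_]; last by rewrite orbF.
by have [_ vu_lt _] := extra_edge_bounds vu; have := ltn_trans uv vu_lt; rewrite ltnn.
Qed.

Lemma star_plus_simple : simple_graph sp.
Proof.
split=> [u v|u]; last by rewrite /star_plus eqxx.
by rewrite /star_plus eq_sym orbCA; congr (_ && (_ || (_ || _))); exact: orbC.
Qed.

Lemma star_plus_connected : connected_graph sp.
Proof.
have [s_sym _] := star_plus_simple.
have csym : connect_sym sp by apply: sym_connect_sym.
have to0 v : connect sp ord0 v.
  have [-> //|v0] := eqVneq v ord0; apply: connect1.
  by rewrite star_plus_lt //= lt0n.
by move=> u v; apply: connect_trans (to0 v); rewrite csym.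
Qed.

(** Stated for arbitrary summands, because it yields the edge count, the degrees and the Platt index
    alike. *)
Lemma star_plus_edge_sum (V : nmodType) (G : nat -> nat -> V) :
  \sum_(p : 'I_n.+1 * 'I_n.+1 | (val p.1 < val p.2)%N && sp p.1 p.2)
     G (val p.1) (val p.2) =
  \sum_(v < n) G 0%N v.+1 + \sum_(q <- L) G q.1 q.2.
Proof.
rewrite (bigID (fun p : 'I_n.+1 * 'I_n.+1 => p.1 == ord0)) /=; congr (_ + _).
  rewrite -(@big_mkord _ _ _ n xpredT (fun v => G 0%N v.+1)).
  rewrite (eq_bigl (fun p : 'I_n.+1 * 'I_n.+1 => (p.1 == ord0) && (p.2 != ord0))).
    rewrite -(pair_big (fun i => i == ord0) (fun j => j != ord0)
      (fun i j : 'I_n.+1 => G (val i) (val j))) /= big_pred1_eq.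
    by rewrite big_mkord big_mkcond big_ord_recl /= add0r.
  move=> [i j] /=; have [->|i0] := eqVneq i ord0; last by rewrite !andbF.
  case: (ltnP (ord0 : 'I_n.+1) j) => [j0|]; last first.
    by rewrite leqn0 => /eqP j0; rewrite -val_eqE /= j0.
  by rewrite star_plus_lt //= -val_eqE -lt0n.
have -> : \sum_(q <- L) G q.1 q.2 =
    \sum_(q <- map (@pair_val n.+1) (enum [pred p | pair_val p \in L])) G q.1 q.2.
  apply: perm_big; apply: uniq_perm.
  - by case/andP: L_ok.
  - by rewrite map_inj_uniq ?enum_uniq //; exact: pair_val_inj.
  move=> [a b]; apply/idP/mapP => [ab|[p]].
    have [a0 lt_ab bn] := extra_edge_bounds ab.
    exists (Ordinal (ltn_trans lt_ab bn), Ordinal bn) => //.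
    by rewrite mem_enum.
  by rewrite mem_enum => p_in ->.
rewrite big_map big_enum_cond /=; apply: eq_bigl => [[i j]] /=.
rewrite unfold_in /= andbT.
apply/idP/idP => [/andP[/andP[ij]]|ij_in].
  by rewrite star_plus_lt // -val_eqE /= => /orP[/eqP ->|->].
have [i0 ij jn] := extra_edge_bounds ij_in.
by rewrite ij star_plus_lt // ij_in orbT -val_eqE /= -lt0n.
Qed.

End StarPlus.

Definition extra_deg (L : seq (nat * nat)) (v : nat) : nat :=
  (\sum_(q <- L) ((v == q.1) + (v == q.2)))%N.

(** Writing a degree as a sum of incidences over edges puts it in the form that [star_plus_edge_sum]
    evaluates. *)
Lemma deg_edges n (e : rel 'I_n) : simple_graph e -> forall v,
  deg e v = (\sum_(p : 'I_n * 'I_n | (val p.1 < val p.2)%N && e p.1 p.2)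
               ((val v == val p.1) + (val v == val p.2)))%N.
Proof.
move=> [e_sym e_irr] v.
rewrite big_split /= degE (bigID (fun y => (val v < val y)%N)) /=; congr addn.
  rewrite [RHS](eq_bigr (fun p => if p.1 == v then 1%N else 0%N)); last first.
    by move=> p _; rewrite -val_eqE eq_sym; case: (_ == _).
  rewrite -!big_mkcondr /= (reindex_onto (fun y => (v, y)) snd) /=; last first.
    by move=> [a b] /= /andP[_ /eqP ->].
  by apply: eq_bigl => y; rewrite !eqxx !andbT.
rewrite [RHS](eq_bigr (fun p => if p.2 == v then 1%N else 0%N)); last first.
  by move=> p _; rewrite -val_eqE eq_sym; case: (_ == _).
rewrite -!big_mkcondr /= (reindex_onto (fun y => (y, v)) fst) /=; last first.
  by move=> [a b] /= /andP[_ /eqP ->].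
apply: eq_bigl => y; rewrite !eqxx !andbT -leqNgt leq_eqVlt e_sym.
by have [/val_inj ->|//] := eqVneq (val y) (val v); rewrite e_irr !andbF.
Qed.

Section StarPlusDegree.
Variables (n : nat) (L : seq (nat * nat)).
Hypothesis L_ok : extra_edges n.+1 L.
Local Notation sp := (@star_plus L n.+1).

Lemma star_plus_cyclic : cyclic_class (size L) sp.
Proof.
split; first exact: star_plus_simple.
split; first exact: (star_plus_connected L_ok).
have H : (\sum_(p : 'I_n.+1 * 'I_n.+1 | (val p.1 < val p.2)%N && sp p.1 p.2) 1 =
    \sum_(v < n) 1 + \sum_(q <- L) 1)%N := star_plus_edge_sum L_ok (fun _ _ => 1%N).
rewrite /nedges -sum1_card; under eq_bigl do rewrite inE.
by rewrite H !sum1_card sum1_size card_ord; lia.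
Qed.

Lemma deg_star_plus (v : 'I_n.+1) :
  deg sp v = if val v == 0%N then n else (extra_deg L (val v)).+1.
Proof.
rewrite (deg_edges (star_plus_simple _ _)).
have H : (\sum_(p : 'I_n.+1 * 'I_n.+1 | (val p.1 < val p.2)%N && sp p.1 p.2)
      ((val v == val p.1) + (val v == val p.2)) =
    \sum_(w < n) ((val v == 0%N) + (val v == w.+1)) + extra_deg L (val v))%N :=
  star_plus_edge_sum L_ok (fun a b : nat => (val v == a) + (val v == b))%N.
rewrite H big_split /= sum_nat_const card_ord.
case: (unliftP ord0 v) => [w ->|->] /=.
  rewrite (bigD1 w) //= eqxx big1 => [|u uw].
    by rewrite muln0 addn0 add1n.
  by rewrite /bump /= eqSS val_eqE eq_sym (negPf uw).
rewrite muln1 big1 ?addn0 // /extra_deg big_seq big1 ?addn0 // => -[a b] ab /=.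
have [] := extra_edge_bounds L_ok ab.
by case: a {ab} => //; case: b.
Qed.

Lemma Platt_star_plus (R : realType) (alpha : R) :
  Platt alpha sp = \sum_(v < n) line_pow alpha (n + extra_deg L v.+1 - 1) +
    \sum_(q <- L) line_pow alpha (extra_deg L q.1 + extra_deg L q.2).
Proof.
pose d (k : nat) := if k == 0%N then n else (extra_deg L k).+1.
have := star_plus_edge_sum L_ok (fun a b : nat => line_pow alpha (d a + d b - 2)).
rewrite /Platt => H; etransitivity.
  by apply: eq_bigr => p _; rewrite !deg_star_plus; reflexivity.
(* The centre has degree [n] and any other vertex one more than its extra degree: subtracting 2
   leaves [- 1] on a star edge and nothing on an extra edge. *)
rewrite H; congr (_ + _); first by apply: eq_bigr => v _; congr line_pow; rewrite /d /=; lia.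
rewrite [LHS]big_seq_cond [RHS]big_seq_cond; apply: eq_bigr => -[a b] /andP[ab _].
have [a0 lt_ab _] := extra_edge_bounds L_ok ab.
by congr line_pow; rewrite /d /= !gtn_eqF ?(ltn_trans a0 lt_ab) //; lia.
Qed.
End StarPlusDegree.

(** * Down-closed sets of at most four pairs *)

Definition staircase (s : seq (nat * nat)) : Prop :=
  forall a b a' b', (a, b) \in s -> (0 < a' <= a)%N -> (b' <= b)%N ->
    (a' < b')%N -> (a', b') \in s.

Definition small_pairs : seq (nat * nat) :=
  [:: (1, 2); (1, 3); (1, 4); (1, 5); (2, 3); (2, 4); (2, 5); (3, 4); (3, 5); (4, 5)]%N.

(** Each list follows the order of [small_pairs], so that filtering [small_pairs] yields literally
    one of these lists. *)
Definition staircases (c : nat) : seq (seq (nat * nat)) :=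
  match c with
  | 0 => [:: [::]]
  | 1 => [:: [:: (1, 2)]]
  | 2 => [:: [:: (1, 2); (1, 3)]]
  | 3 => [:: [:: (1, 2); (1, 3); (1, 4)]; [:: (1, 2); (1, 3); (2, 3)]]
  | 4 => [:: [:: (1, 2); (1, 3); (1, 4); (1, 5)]; [:: (1, 2); (1, 3); (1, 4); (2, 3)]]
  | _ => [::]
  end%N.

Lemma staircase_small s : uniq s -> (forall a b, (a, b) \in s -> (0 < a < b)%N) ->
  staircase s -> (size s <= 4)%N ->
  exists2 L, L \in staircases (size s) & perm_eq s L.
Proof.
move=> s_uniq s_ord s_stair s_size.
(* A pair [(a, b)] forces [(1, 2)], ..., [(1, b)] into [s], hence [b - 1 <= 4]. *)
have le5 a b : (a, b) \in s -> (b <= 5)%N.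
  move=> ab; have /andP[a0 ab_lt] := s_ord _ _ ab.
  have : uniq [seq (1, k)%N | k <- iota 2 (b - 1)].
    by rewrite map_inj_uniq ?iota_uniq // => x y [].
  move=> /(uniq_leq_size (s2 := s)); rewrite size_map size_iota => H.
  suff : (b - 1 <= size s)%N by lia.
  apply: H => _ /mapP[k + ->]; rewrite mem_iota => k_in.
  by apply: (s_stair a b) => //; lia.
have s_perm : perm_eq s [seq p <- small_pairs | p \in s].
  apply: uniq_perm => //; first by rewrite filter_uniq.
  move=> [a b]; rewrite mem_filter; case: ((a, b) \in s) / idP => //= ab.
  move: (s_ord _ _ ab) (le5 _ _ ab) => {ab} /andP[].
  by case: b => [|[|[|[|[|[|b]]]]]] //; case: a => [|[|[|[|[|[|a]]]]]].
have s_sizeE := perm_size s_perm.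
suff : [seq p <- small_pairs | p \in s] \in staircases (size s).
  by exists [seq p <- small_pairs | p \in s].
have st a b a' b' : (0 < a' <= a)%N && (b' <= b)%N && (a' < b')%N ->
    (a, b) \in s -> (a', b') \in s.
  by move=> /andP[/andP[? ?] ?] ab; apply: (s_stair a b).
(* These twelve implications are the covering relations of the order on the ten pairs. Running
   through all membership patterns, each one breaks an implication, exceeds four pairs, or is
   listed. *)
move: (st 1 3 1 2 isT) (st 1 4 1 3 isT) (st 1 5 1 4 isT) (st 2 3 1 3 isT)
  (st 2 4 1 4 isT) (st 2 4 2 3 isT) (st 2 5 1 5 isT) (st 2 5 2 4 isT)
  (st 3 4 2 4 isT) (st 3 5 2 5 isT) (st 3 5 3 4 isT) (st 4 5 3 5 isT) => /=.
rewrite s_sizeE in s_size *; rewrite /= in s_size *; move: s_size.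
do 10![case: (_ \in s); first last => /=].
all: move=> *; by [|exfalso; auto].
Qed.

(** * Compressed graphs as stars with extra edges *)

Lemma eq_deg n (e e' : rel 'I_n) : e =2 e' -> deg e =1 deg e'.
Proof. by move=> ee' x; rewrite /deg; apply: eq_card => y; rewrite !inE ee'. Qed.

Lemma eq_nedges n (e e' : rel 'I_n) : e =2 e' -> nedges e = nedges e'.
Proof. by move=> ee'; apply: eq_card => p; rewrite !inE ee'. Qed.

Lemma eq_Platt (R : realType) (alpha : R) n (e e' : rel 'I_n) : e =2 e' ->
  Platt alpha e = Platt alpha e'.
Proof.
move=> ee'; apply: eq_big => [p|p _]; first by rewrite ee'.
by rewrite !(eq_deg ee').
Qed.

Lemma eq_cyclic_class c n (e e' : rel 'I_n) : e =2 e' ->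
  cyclic_class c e -> cyclic_class c e'.
Proof.
move=> ee' [[e_sym e_irr] [e_conn e_edges]]; split; [split|split].
- by move=> x y; rewrite -!ee' e_sym.
- by move=> x; rewrite -ee' e_irr.
- by move=> x y; rewrite -(eq_connect ee').
- by rewrite -(eq_nedges ee').
Qed.

Lemma eq_star_plus L L' n : L =i L' -> star_plus L n =2 star_plus L' n.
Proof. by move=> LL' u v; rewrite /star_plus !LL'. Qed.

Lemma compressed_star_plus (c n : nat) (e : rel 'I_n.+1) :
    cyclic_class c e -> compressed e -> (c <= 4)%N ->
  exists L, [/\ L \in staircases c, extra_edges n.+1 L & e =2 star_plus L n.+1].
Proof.
move=> [e_simple [e_conn e_edges]] e_comp c4; have [e_sym e_irr] := e_simple.
have univ := compressed_universal e_simple e_conn e_comp.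
have shift := compressed_shifted e_simple e_conn e_comp.
(* The edges avoiding vertex 0, each listed once with increasing ends. *)
pose s := map (@pair_val n.+1)
  (enum [pred p : 'I_n.+1 * 'I_n.+1 | (0 < p.1 < p.2)%N && e p.1 p.2]).
have s_mem a b : (a, b) \in s ->
    exists u v : 'I_n.+1, [/\ a = u, b = v, (0 < u < v)%N & e u v].
  move=> /mapP[[u v]]; rewrite mem_enum inE /= => /andP[uv euv] [-> ->].
  by exists u, v.
have mem_s (u v : 'I_n.+1) : (0 < u < v)%N -> e u v -> (val u, val v) \in s.
  move=> uv euv; apply/mapP; exists (u, v) => //.
  by rewrite mem_enum inE /= uv euv.
have s_ok : extra_edges n.+1 s.
  apply/andP; split; first by rewrite map_inj_uniq ?enum_uniq //; exact: pair_val_inj.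
  by apply/allP => -[a b] /s_mem[u [v [-> -> uv _]]]; rewrite /= uv ltn_ord.
have s_e : e =2 star_plus s n.+1.
  suff lt_case (u v : 'I_n.+1) : (u < v)%N -> e u v = star_plus s n.+1 u v.
    move=> u v; case: (ltngtP u v) => [|vu|/val_inj ->]; first exact: lt_case.
      by have [sp_sym _] := star_plus_simple n s; rewrite e_sym sp_sym lt_case.
    by rewrite e_irr /star_plus eqxx.
  move=> uv; rewrite star_plus_lt //.
  have [u0|u0] := posnP u.
    rewrite /=; have -> : u = ord0 by apply: val_inj.
    by apply: univ; rewrite -val_eqE /= -lt0n -{1}u0.
  rewrite /=; apply/idP/idP => [euv|]; first by apply: mem_s; rewrite ?uv ?u0.
  by move=> /s_mem[u' [v' []]] /= /val_inj -> /val_inj ->.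
have s_size : size s = c.
  have [_ [_ sp_edges]] := star_plus_cyclic s_ok.
  by move: sp_edges; rewrite -(eq_nedges s_e) e_edges => /addnI.
have s_stair : staircase s.
  move=> a b a' b' /s_mem[u [v [-> -> /andP[u0 uv] euv]]] a'u b'v ab'.
  have b'n : (b' < n.+1)%N by apply: leq_ltn_trans b'v (ltn_ord v).
  have a'n : (a' < n.+1)%N by apply: ltn_trans ab' b'n.
  pose x : 'I_n.+1 := Ordinal a'n; pose y : 'I_n.+1 := Ordinal b'n.
  (* The smaller end is lowered first, then the larger one; [a' < b' <= b] keeps the two ends
     distinct at both stages. *)
  have exv : e x v.
    case/andP: a'u => a'0; rewrite leq_eqVlt => /orP[/eqP a'E|a'_lt].
      by have -> : x = u by apply: val_inj.
    apply: (shift x u) => //=; first by rewrite a'0.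
    by rewrite -val_eqE /= gtn_eqF // (leq_trans ab').
  have exy : e x y.
    rewrite e_sym; move: b'v; rewrite leq_eqVlt => /orP[/eqP b'E|b'_lt].
      by rewrite (_ : y = v) 1?e_sym //; apply: val_inj.
    apply: (shift y v) => //=; last by rewrite e_sym.
      by rewrite b'_lt andbT; case/andP: a'u => a'0 _; apply: ltn_trans ab'.
    by rewrite -val_eqE /= ltn_eqF.
  by apply: (mem_s x y) => //=; case/andP: a'u => ->.
have [|||L L_in sL] := staircase_small _ _ s_stair; first by case/andP: s_ok.
- by move=> a b /s_mem[u [v [-> -> uv _]]].
- by rewrite s_size.
exists L; split; first by rewrite -s_size.
  case/andP: s_ok => s_uniq s_all; apply/andP; split; first by rewrite -(perm_uniq sL).
  by rewrite -(perm_all _ sL).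
by move=> u v; rewrite s_e; apply: eq_star_plus; exact: perm_mem.
Qed.

(** * Comparison of the extremal candidates *)

Section PlattBound.
Variables (R : realType) (alpha : R).
Local Notation f := (line_pow alpha).

Lemma line_pow_diff2 k : fdiff2 alpha k%:R = f k.+2 - f k.+1 - (f k.+1 - f k).
Proof. by rewrite /line_pow -!natr1. Qed.

Lemma line_pow_diff3 k :
  fdiff3 alpha k%:R = f k.+3 - 3 * f k.+2 + 3 * f k.+1 - f k.
Proof. by rewrite /fdiff3 natr1 !line_pow_diff2; ring. Qed.

(** Only the first [k] leaves can meet [L]; the other [m] are pendant and contribute equal terms.
    For a concrete [L] the rest is a finite sum that computes, with [m] symbolic. *)
Lemma Platt_star_plus_seq (k m : nat) (L : seq (nat * nat)) :
    extra_edges (k + m).+1 L -> all (fun q => q.2 <= k)%N L ->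
  Platt alpha (star_plus L (k + m).+1) =
  \sum_(d <- [seq extra_deg L v | v <- iota 1 k]) f (k + m + d - 1) +
  f (k + m - 1) *+ m +
  \sum_(q <- L) f (extra_deg L q.1 + extra_deg L q.2).
Proof.
move=> L_ok L_le; rewrite Platt_star_plus //; congr (_ + _).
rewrite big_split_ord /=; congr (_ + _).
  rewrite big_map (iotaDl 1 0 k : iota 1 k = _) big_map.
  by rewrite -(big_mkord xpredT (fun i => f (k + m + extra_deg L i.+1 - 1))) /index_iota subn0.
rewrite -[X in _ *+ X]card_ord -sumr_const; apply: eq_bigr => i _.
suff -> : extra_deg L (k + i).+1 = 0%N by rewrite addn0.
rewrite /extra_deg big_seq big1 // => -[a b] ab /=.
have [_ lt_ab _] := extra_edge_bounds L_ok ab.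
have /= le_bk := allP L_le _ ab.
by rewrite !gtn_eqF // ltnS; lia.
Qed.

Lemma Platt_G4 m : Platt alpha (G4 m.+1.+4) =
  f m.+2.+4 + 3 * f m.+4 + f m.+3 *+ m + 3 * f 4.
Proof.
rewrite /G4 (@Platt_star_plus_seq 4 m) //.
rewrite /= /extra_deg !big_cons !big_nil /= !addnS !addn0 !subn1 /=.
by ring.
Qed.

Lemma Platt_G5 m : Platt alpha (G5 m.+1.+4) =
  3 * f m.+1.+4 + f m.+3 + f m.+3 *+ m + 3 * f 4.
Proof.
rewrite /G5 (@Platt_star_plus_seq 4 m) //.
rewrite /= /extra_deg !big_cons !big_nil /= !addnS !addn0 !subn1 /=.
by ring.
Qed.

(** In both graphs the three extra edges contribute [3 * f 4] and cancel; the star edges leave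
    exactly a third difference. *)
Lemma Platt_G4_G5 m :
  Platt alpha (G4 m.+1.+4) - Platt alpha (G5 m.+1.+4) = fdiff3 alpha m.+3%:R.
Proof. by rewrite Platt_G4 Platt_G5 line_pow_diff3; ring. Qed.

Hypothesis alpha_ge1 : 1 <= alpha.

Lemma line_pow0 : f 0 = 0.
Proof. by rewrite /line_pow powR0 // gt_eqF // (lt_le_trans ltr01). Qed.

Lemma line_pow_homo : {homo f : x y / (x <= y)%N >-> x <= y}.
Proof.
move=> x y xy; apply: ge0_ler_powR; rewrite ?nnegrE ?ler0n ?ler_nat //.
by rewrite (le_trans ler01).
Qed.

Lemma line_pow_convex k : f k.+1 - f k <= f k.+2 - f k.+1.
Proof.
(* The sign of [fdiff2] is known only at positive arguments; at 0 the claim is [2 <= 2^alpha]. *)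
case: k => [|k]; last first.
  by rewrite -subr_ge0 -line_pow_diff2 fdiff2_ge0 // ltr0n.
rewrite line_pow0 /line_pow powR1; have : 2 `^ 1 <= 2 `^ alpha.
  by apply: ler_powR => //; lra.
by rewrite powRr1; lra.
Qed.

Lemma Platt_le_star_plus (c n : nat) (e : rel 'I_n.+1) :
    cyclic_class c e -> (c <= 4)%N ->
  exists L, [/\ L \in staircases c, extra_edges n.+1 L &
             Platt alpha e <= Platt alpha (star_plus L n.+1)].
Proof.
move=> [e_simple [e_conn e_edges]] c4.
have [e' [s' c' n' le' comp']] :=
  compressed_exists line_pow_convex line_pow0 line_pow_homo e_simple e_conn.
have [|L [L_in L_ok e'E]] := compressed_star_plus (e := e') _ comp' c4.
  by split => //; split => //; rewrite n'.
by exists L; split => //; rewrite -(eq_Platt _ e'E).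
Qed.

(** A triangle with a pendant edge. It is the list of [H5] with every pair increasing, as
    [extra_edges] requires. *)
Definition paw : seq (nat * nat) := [:: (1, 2); (1, 3); (1, 4); (2, 3)]%N.

Lemma H5_paw n : H5 n =2 star_plus paw n.
Proof.
move=> u v; rewrite /H5 /star_plus; congr (_ && _); congr (_ || _); congr (_ || _).
rewrite !inE !xpair_eqE.
do ![case: (val u == _) => //=; case: (val v == _) => //=].
Qed.

(** With [D2 k] and [D3 k] the second and third differences of [f] starting at [k], the gap is
    [D2 (m+6) + D3 (m+4) + 2 * (f 5 - f 4)]. For [alpha >= 2] every term is nonnegative. *)
Lemma Platt_paw_le_H4 m :
  Platt alpha (star_plus paw m.+2.+4) <= Platt alpha (H4 m.+2.+4).
Proof.
rewrite /H4 !(@Platt_star_plus_seq 5 m) //.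
rewrite /= /extra_deg !big_cons !big_nil /= !addnS !addn0 !subn1 /=.
have g0 k : 0 <= f k.+1 - f k by rewrite subr_ge0 line_pow_homo.
have d2 k : 0 <= f k.+2 - f k.+1 - (f k.+1 - f k) by rewrite subr_ge0 line_pow_convex.
have [a2|a2] := leP 2 alpha.
  have d3 k : 0 <= f k.+4 - 3 * f k.+3 + 3 * f k.+2 - f k.+1.
    by rewrite -line_pow_diff3 fdiff3_ge0 // ltr0n.
  have := d3 m.+3; have := d2 m.+2.+4; have := g0 4%N.
  by lra.
have d3 k : f k.+4 - 3 * f k.+3 + 3 * f k.+2 - f k.+1 <= 0.
  by rewrite -line_pow_diff3 fdiff3_le0 ?ltr0n // alpha_ge1 ltW.
(* For [alpha < 2] the second differences decrease, so [D2 (m+4) <= D2 3 <= f 5 - f 4]. This absorbs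
   the negative part of [D3 (m+4) = D2 (m+5) - D2 (m+4)]. *)
have d2_le : f m.+2.+4 - f m.+1.+4 - (f m.+1.+4 - f m.+4) <=
    f 5 - f 4 - (f 4 - f 3).
  elim: m => [|m IH]; first by have := d3 2%N; lra.
  by have := d3 m.+3; lra.
have := d2 m.+1.+4; have := d2 m.+2.+4; have := g0 4%N; have := g0 3%N.
by lra.
Qed.

End PlattBound.

(** * The extremal graphs for each cyclomatic number *)

Theorem theorem7 (R : realType) (alpha : R) (halpha : 1 <= alpha) :
  (* (1) trees *)
  (forall n : nat, (1 <= n)%N ->
     is_tree (Star n) /\
     forall e : rel 'I_n, is_tree e -> Platt alpha e <= Platt alpha (Star n)) /\
  (* (2) unicyclic graphs *)
  (forall n : nat, (3 <= n)%N ->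
     is_unicyclic (Star_plus n) /\
     forall e : rel 'I_n, is_unicyclic e ->
       Platt alpha e <= Platt alpha (Star_plus n)) /\
  (* (3) bicyclic graphs *)
  (forall n : nat, (4 <= n)%N ->
     is_bicyclic (B1 n) /\
     forall e : rel 'I_n, is_bicyclic e -> Platt alpha e <= Platt alpha (B1 n)) /\
  (* (4) tricyclic graphs *)
  (forall n : nat, (5 <= n)%N ->
     is_tricyclic (G4 n) /\ is_tricyclic (G5 n) /\
     (forall e : rel 'I_n, is_tricyclic e ->
        Platt alpha e <= Num.max (Platt alpha (G4 n)) (Platt alpha (G5 n))) /\
     (1 < alpha < 2 -> Platt alpha (G4 n) < Platt alpha (G5 n)) /\
     (2 < alpha -> Platt alpha (G4 n) > Platt alpha (G5 n)) /\
     ((alpha = 1 \/ alpha = 2) -> Platt alpha (G4 n) = Platt alpha (G5 n))) /\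
  (* (5) tetracyclic graphs *)
  (forall n : nat, (6 <= n)%N ->
     is_tetracyclic (H4 n) /\
     forall e : rel 'I_n, is_tetracyclic e ->
       Platt alpha e <= Platt alpha (H4 n)) /\
  (is_tetracyclic (H5 5) /\
   forall e : rel 'I_5, is_tetracyclic e -> Platt alpha e <= Platt alpha (H5 5)).
Proof.
have le_of c n (e : rel 'I_n.+1) L0 : (c <= 4)%N -> cyclic_class c e ->
    (forall L, L \in staircases c -> extra_edges n.+1 L ->
       Platt alpha (star_plus L n.+1) <= Platt alpha (star_plus L0 n.+1)) ->
    Platt alpha e <= Platt alpha (star_plus L0 n.+1).
  move=> c4 e_cyc H; have [L [L_in L_ok le_e]] := Platt_le_star_plus halpha e_cyc c4.
  exact: le_trans le_e (H L L_in L_ok).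
have H5_cyc n : is_tetracyclic (H5 n.+1.+4).
  have paw_ok : extra_edges n.+1.+4 paw by [].
  apply: (@eq_cyclic_class 4 _ (star_plus paw n.+1.+4)); last exact: star_plus_cyclic paw_ok.
  by move=> u v; rewrite H5_paw.
split; [|split; [|split; [|split; [|split]]]].
- case=> // n _; have L_ok : extra_edges n.+1 [::] by [].
  split; first exact: star_plus_cyclic L_ok.
  by move=> e e_cyc; apply: (le_of 0%N) => // L; rewrite inE => /eqP ->.
- case=> [|[|[|n]]] // _; have L_ok : extra_edges n.+3 [:: (1, 2)]%N by [].
  split; first exact: star_plus_cyclic L_ok.
  by move=> e e_cyc; apply: (le_of 1%N) => // L; rewrite inE => /eqP ->.
- case=> [|[|[|[|n]]]] // _; have L_ok : extra_edges n.+4 [:: (1, 2); (1, 3)]%N by [].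
  split; first exact: star_plus_cyclic L_ok.
  by move=> e e_cyc; apply: (le_of 2%N) => // L; rewrite inE => /eqP ->.
- case=> [|[|[|[|[|n]]]]] // _.
  have G4_ok : extra_edges n.+1.+4 [:: (1, 2); (1, 3); (1, 4)]%N by [].
  have G5_ok : extra_edges n.+1.+4 [:: (1, 2); (2, 3); (1, 3)]%N by [].
  have x_gt0 : 0 < n.+3%:R :> R by rewrite ltr0n.
  split; first exact: star_plus_cyclic G4_ok.
  split; first exact: star_plus_cyclic G5_ok.
  split.
    move=> e e_cyc; have [L [L_in _ le_e]] := Platt_le_star_plus halpha e_cyc isT.
    rewrite le_max; move: L_in le_e; rewrite !inE => /orP[] /eqP -> le_e.
      by rewrite le_e.
    (* The triangle from [staircases] and the list of [G5] differ only in the order of their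
       pairs. *)
    apply/orP; right; apply: le_trans le_e _; rewrite le_eqVlt; apply/orP; left.
    by apply/eqP/eq_Platt/eq_star_plus => q; rewrite !inE; congr (_ || _); rewrite orbC.
  split; first by move=> a12; rewrite -subr_lt0 Platt_G4_G5; exact: fdiff3_lt0.
  split; first by move=> a2; rewrite -subr_gt0 Platt_G4_G5; exact: fdiff3_gt0.
  move=> a12; apply/eqP; rewrite -subr_eq0 Platt_G4_G5.
  by case: a12 => ->; rewrite ?fdiff3_1 ?fdiff3_2 // ltW.
- case=> [|[|[|[|[|[|n]]]]]] // _.
  have H4_ok : extra_edges n.+2.+4 [:: (1, 2); (1, 3); (1, 4); (1, 5)]%N by [].
  split; first exact: star_plus_cyclic H4_ok.
  move=> e e_cyc; apply: (le_of 4%N) => // L; rewrite !inE => /orP[] /eqP -> // _.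
  exact: Platt_paw_le_H4.
- split; first exact: (H5_cyc 0%N).
  (* On five vertices the star of four extra edges would need the label 5, so [extra_edges] rules it
     out and only [paw] remains. *)
  move=> e e_cyc; apply: (le_of 4%N) => // L; rewrite !inE => /orP[] /eqP -> // _.
  by rewrite (eq_Platt _ (@H5_paw 5)).
Qed.
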